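(* Let $p,q$ be coprime positive odd integers, and let $a,b$ be odd integers with $0<a<2p$ and $0<b<q$. For every integer $n$, $$Y_{(n+1,a,b)}(t)=D(t)\,Y_{(n,a,b)}(t)-Y_{(n-1,a,b)}(t),$$ where $$D(t)=2T_{2pq}\!\left(\frac{\sqrt t}{2\sqrt{C_{(2p,q,a,b)}}}\right).$$
   Context: $T_m(x)$ is the $m$-th Tchebychev polynomial of the first kind, $T_m(\cos\theta)=\cos m\theta$. Put $$C_{(2p,q,a,b)}=\left(1-\cos\frac{a\pi}{2p}\right)\left(1-\cos\frac{b\pi}{q}\right)>0 .$$ For an integer $n$ let $N=|2pqn+1|$ (an odd integer), and define polynomials in $t$ by $Y_{(0,a,b)}(t)=1$ and, for $n\neq0$, $$Y_{(n,a,b)}(t)=\varepsilon_n\, 2C_{(2p,q,a,b)}\,\frac{T_{N+1}\!\left(\frac{\sqrt t}{2\sqrt{C_{(2p,q,a,b)}}}\right)-T_{N-1}\!\left(\frac{\sqrt t}{2\sqrt{C_{(2p,q,a,b)}}}\right)}{t-4C_{(2p,q,a,b)}},$$ where $\varepsilon_n=1$ if $n>0$ and $\varepsilon_n=-1$ if $n<0$. Equivalently $Y_{(n,a,b)}(t)=X_n\!\left(\frac{\sqrt t}{2\sqrt{C_{(2p,q,a,b)}}}\right)$ with $X_0=1$ and $X_n(x)=\varepsilon_n\frac{T_{N+1}(x)-T_{N-1}(x)}{2(x^2-1)}$ for $n\ne0$. (These are even polynomials in $x$, so $Y_{(n,a,b)}$ is a polynomial in $t$; likewise $D(t)$ since $2pq$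 is even.) *)

(* Defs.v *)
From mathcomp Require Import all_boot all_order all_algebra.
From mathcomp Require Import all_classical all_reals all_analysis.
From mathcomp Require Import ring lra zify.

Set Implicit Arguments.
Unset Strict Implicit.
Unset Printing Implicit Defensive.

Import Order.TTheory GRing.Theory Num.Theory.
Local Open Scope ring_scope.

(* Tchebychev polynomials of the first kind; see [chebT_cos]. *)
Fixpoint chebT (R : realType) (m : nat) : {poly R} :=
  match m with
  | 0%N => 1
  | m1.+1 => match m1 with
             | 0%N => 'X
             | m2.+1 => 2 *: ('X * chebT R m1) - chebT R m2
             end
  end.

(* C_{(2p,q,a,b)}; [p] is the half of the first index. *)
Definition constC (R : realType) (p q a b : nat) : R :=
  (1 - cos (a%:R * pi / (2 * p%:R))) * (1 - cos (b%:R * pi / q%:R)).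

(* For an even polynomial P, the polynomial in t given by
   P (sqrt t / (2 sqrt C)): if P = \sum_i c_i x^(2i) it is
   \sum_i c_i (t / (4 C))^i; see [subst_sqrtE]. *)
Definition subst_sqrt (R : realType) (C : R) (P : {poly R}) : {poly R} :=
  even_poly P \Po ((4 * C)^-1 *: 'X).

Definition absN (p q : nat) (n : int) : nat :=
  absz ((2 * p * q)%N%:Z * n + 1).

(* The Euclidean quotient is exact; see [Ypoly_mul] and [Ypoly_horner]. *)
Definition Ypoly (R : realType) (p q a b : nat) (n : int) : {poly R} :=
  let C := constC R p q a b in
  let N := absN p q n in
  let eps : R := if 0 < n then 1 else -1 in
  if n == 0 then 1 else
    ((eps * (2 * C)) *:
      (subst_sqrt C (chebT R N.+1) - subst_sqrt C (chebT R N.-1)))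
    %/ ('X - (4 * C)%:P).

Definition Dpoly (R : realType) (p q a b : nat) : {poly R} :=
  2 *: subst_sqrt (constC R p q a b) (chebT R (2 * p * q)%N).

Lemma chebTSS (R : realType) m :
  chebT R m.+2 = 2 *: ('X * chebT R m.+1) - chebT R m.
Proof. by []. Qed.

Lemma chebT_cos (R : realType) (m : nat) (x : R) :
  (chebT R m).[cos x] = cos (m%:R * x).
Proof.
elim/ltn_ind: m => -[|[|m]] IH.
- by rewrite hornerC mul0r cos0.
- by rewrite /= hornerX mul1r.
rewrite chebTSS hornerD hornerN hornerZ hornerM hornerX !IH //.
have -> : m.+2%:R * x = m.+1%:R * x + x :> R by rewrite -!natr1; ring.
have -> : m%:R * x = m.+1%:R * x - x :> R by rewrite -!natr1; ring.
by rewrite cosB cosD; ring.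
Qed.

Lemma chebT1 (R : realType) m : (chebT R m).[1] = 1.
Proof. by rewrite -cos0 chebT_cos mulr0. Qed.

Lemma odd_chebT (R : realType) m :
  (odd m -> even_poly (chebT R m) = 0) /\
  (~~ odd m -> odd_poly (chebT R m) = 0).
Proof.
elim/ltn_ind: m => -[|[|m]] IH.
- by split=> // _; rewrite odd_polyC.
- split=> // _; rewrite /= -['X]mul1r.
  by rewrite even_polyMX odd_polyC mul0r.
have [H1 H2] := IH m.+1 (leqnn _); have [H3 H4] := IH m (leqnSn _).
rewrite chebTSS [odd m.+2]/= negbK; split=> h.
  rewrite raddfB /= even_polyZ (mulrC 'X) even_polyMX H2 /= ?h // H3 ?mul0r //.
  by rewrite scaler0 subr0.
rewrite raddfB /= odd_polyZ (mulrC 'X) odd_polyMX H1 ?[odd _]/= // H4 //.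
by rewrite scaler0 subr0.
Qed.

Lemma subst_sqrtE (R : realType) (C t : R) (P : {poly R}) :
  odd_poly P = 0 -> 0 < C -> 0 <= t ->
  (subst_sqrt C P).[t] = P.[Num.sqrt t / (2 * Num.sqrt C)].
Proof.
move=> oP C0 t0; rewrite -[in RHS](poly_even_odd P) oP comp_poly0 mul0r addr0.
rewrite /subst_sqrt !horner_comp hornerZ hornerX hornerXn.
congr (_.[_]); rewrite expr_div_n exprMn !sqr_sqrtr ?(ltW C0) //.
by rewrite -natrX mulrC.
Qed.

Lemma constC_gt0 (R : realType) (p q a b : nat) :
  (0 < a < 2 * p)%N -> (0 < b < q)%N -> 0 < constC R p q a b.
Proof.
have aux (k l : nat) : (0 < k < l)%N -> 0 < 1 - cos (k%:R * pi / l%:R : R).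
  case/andP=> k0 kl; have l0 : 0 < l%:R :> R by rewrite ltr0n (leq_trans _ kl).
  have x0 : 0 < k%:R * pi / l%:R :> R.
    by rewrite divr_gt0 // mulr_gt0 ?pi_gt0 // ltr0n.
  have xpi : k%:R * pi / l%:R <= pi :> R.
    by rewrite ler_pdivrMr // mulrC ler_wpM2l ?pi_ge0 // ler_nat ltnW.
  rewrite subr_gt0 -[ltRHS]cos0 ltr_cos // ?in_itv /= ?lexx ?pi_ge0 //.
  by rewrite xpi ltW.
by move=> ha hb; rewrite /constC mulr_gt0 ?aux // -natrM aux.
Qed.

Lemma absN_odd p q n : odd (absN p q n).
Proof. by rewrite /absN; lia. Qed.

Lemma Ypoly_mul (R : realType) (p q a b : nat) (n : int) :
  0 < constC R p q a b -> n != 0 ->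
  let C := constC R p q a b in let N := absN p q n in
  ('X - (4 * C)%:P) * Ypoly R p q a b n =
  ((if 0 < n then 1 else -1) * (2 * C)) *:
    (subst_sqrt C (chebT R N.+1) - subst_sqrt C (chebT R N.-1)).
Proof.
move=> C0 n0 C N; rewrite /Ypoly (negPf n0) -/C -/N mulrC divpK //.
rewrite dvdp_XsubCl rootE hornerZ hornerD hornerN.
have oN : odd N by exact: absN_odd.
have e1 : odd_poly (chebT R N.+1) = 0 by apply: (odd_chebT R _).2; rewrite /= oN.
have e2 : odd_poly (chebT R N.-1) = 0.
  by apply: (odd_chebT R _).2; case: (N) oN.
have C4 : 0 <= 4 * C by rewrite mulr_ge0 // ltW.
rewrite !subst_sqrtE //.
have -> : Num.sqrt (4 * C) / (2 * Num.sqrt C) = 1.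
  have -> : 4 = 2 ^+ 2 :> R by rewrite -natrX.
  rewrite sqrtrM ?sqr_ge0 // sqrtr_sqr ger0_norm // divff //.
  by rewrite mulf_neq0 // gt_eqF // sqrtr_gt0.
by rewrite !chebT1 subrr mulr0.
Qed.

Lemma Ypoly_horner (R : realType) (p q a b : nat) (n : int) (t : R) :
  0 < constC R p q a b -> n != 0 -> 0 <= t -> t != 4 * constC R p q a b ->
  let C := constC R p q a b in let N := absN p q n in
  let x := Num.sqrt t / (2 * Num.sqrt C) in
  (Ypoly R p q a b n).[t] =
  (if 0 < n then 1 else -1) * (2 * C) *
    (((chebT R N.+1).[x] - (chebT R N.-1).[x]) / (t - 4 * C)).
Proof.
move=> C0 n0 t0 tC C N x; have oN : odd N by exact: absN_odd.
have := congr1 (fun P => P.[t]) (Ypoly_mul C0 n0); rewrite /= -/C -/N.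
have e1 : odd_poly (chebT R N.+1) = 0 by apply: (odd_chebT R _).2; rewrite /= oN.
have e2 : odd_poly (chebT R N.-1) = 0.
  by apply: (odd_chebT R _).2; case: (N) oN.
rewrite hornerM hornerXsubC hornerZ hornerD hornerN !subst_sqrtE // -/x => h.
rewrite mulrA -h mulrAC mulfV ?mul1r //.
by rewrite subr_eq0.
Qed.

(* Main.v *)
Require Import Defs.
From mathcomp Require Import all_boot all_order all_algebra.
From mathcomp Require Import all_classical all_reals all_analysis.
From mathcomp Require Import ring zify.

Set Implicit Arguments.
Unset Strict Implicit.
Unset Printing Implicit Defensive.

Import Order.TTheory GRing.Theory Num.Theory.
Local Open Scope ring_scope.

(** Put [sqrt t / (2 sqrt C) = cos u]. Then [Y_n] becomes
    [sin ((2pqn + 1) u) / sin u] and [D] becomes [2 cos (2pqu)], so that the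
    recurrence is the addition formula
    [sin (A + B) + sin (A - B) = 2 sin A cos B].

    The proof carries this out inside the ring of polynomials. Extend the
    Tchebychev polynomials to integer indices by [T_(-m) = T_m], as the parity
    of the cosine dictates. The addition formula for cosines becomes
    [T_(m+k) + T_(m-k) = 2 T_k T_m] ([chebTz_addB]), and for even indices it
    passes to polynomials in [t], because the substitution [x^2 := t / 4C] is
    multiplicative on even polynomials ([subst_sqrtM]). The symmetry in the
    index also absorbs the sign [eps_n] and the absolute value in [N]: for all
    [n], including 0, the signed index [k = 2pqn + 1] gives
    [(t - 4C) Y_n = 2C (T_(k+1) - T_(k-1))] ([Ypoly_mulz]). Moving [n] by one
    moves [k] by [2pq], so the addition formula applied at [k+1] and at [k-1]
    gives the recurrence multiplied by [t - 4C], a factor that can be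
    cancelled. *)

Definition chebTz (R : realType) (m : int) : {poly R} := chebT R (absz m).

Lemma chebTz_step (R : realType) (m : int) :
  chebTz R (m + 1) + chebTz R (m - 1) = 2 *: ('X * chebTz R m).
Proof.
rewrite /chebTz; case: m => [[|m]|m].
- by rewrite /= mulr1 scaler_nat mulr2n.
- have -> : absz (m.+1%:Z + 1) = m.+2 by lia.
  have -> : absz (m.+1%:Z - 1) = m by lia.
  by rewrite chebTSS subrK.
have -> : absz (Negz m + 1) = m by lia.
have -> : absz (Negz m - 1) = m.+2 by lia.
by rewrite chebTSS addrC subrK.
Qed.

(** Both sides satisfy the same second-order recurrence in [k], because
    [chebTz_step] holds on the negative side as well. *)
Lemma chebTz_addB (R : realType) (m : int) (k : nat) :
  chebTz R (m + k%:Z) + chebTz R (m - k%:Z) = 2 *: (chebT R k * chebTz R m).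
Proof.
elim/ltn_ind: k => -[|[|k]] IH.
- by rewrite addr0 mul1r scaler_nat mulr2n.
- exact: chebTz_step.
have IH1 := IH k.+1 (leqnn _); have IH0 := IH k (leqnSn _).
have := chebTz_step R (m + k.+1%:Z); have := chebTz_step R (m - k.+1%:Z).
have -> : m - k.+1%:Z + 1 = m - k%:Z by lia.
have -> : m - k.+1%:Z - 1 = m - k.+2%:Z by lia.
have -> : m + k.+1%:Z + 1 = m + k.+2%:Z by lia.
have -> : m + k.+1%:Z - 1 = m + k%:Z by lia.
move=> eB eD.
have -> : chebTz R (m + k.+2%:Z) =
    2 *: ('X * chebTz R (m + k.+1%:Z)) - chebTz R (m + k%:Z) by rewrite -eD addrK.
have -> : chebTz R (m - k.+2%:Z) =
    2 *: ('X * chebTz R (m - k.+1%:Z)) - chebTz R (m - k%:Z).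
  by rewrite -eB addrAC subrr add0r.
rewrite addrACA -opprD IH0 -scalerDr -mulrDr IH1 chebTSS.
by rewrite mulrBl -!scalerAr -!scalerAl mulrA scalerBr.
Qed.

Lemma even_chebTz (R : realType) (m : int) :
  ~~ odd (absz m) -> odd_poly (chebTz R m) = 0.
Proof. exact: (odd_chebT R _).2. Qed.

Lemma even_poly_comp_sqr (R : comNzRingType) (P : {poly R}) :
  even_poly (P \Po 'X^2) = P.
Proof.
apply/polyP=> i.
by rewrite coef_even_poly coef_comp_poly_Xn // dvdn2 odd_double divn2 doubleK.
Qed.

Lemma even_polyM (R : comNzRingType) (P Q : {poly R}) :
  odd_poly P = 0 -> odd_poly Q = 0 ->
  even_poly (P * Q) = even_poly P * even_poly Q.
Proof.
move=> oP oQ.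
rewrite -{1}(poly_even_odd P) -{1}(poly_even_odd Q) oP oQ !comp_poly0 !mul0r.
by rewrite !addr0 -comp_polyM even_poly_comp_sqr.
Qed.

Lemma subst_sqrtM (R : realType) (C : R) (P Q : {poly R}) :
  odd_poly P = 0 -> odd_poly Q = 0 ->
  subst_sqrt C (P * Q) = subst_sqrt C P * subst_sqrt C Q.
Proof. by move=> oP oQ; rewrite /subst_sqrt even_polyM // rmorphM. Qed.

Lemma subst_sqrtD (R : realType) (C : R) (P Q : {poly R}) :
  subst_sqrt C (P + Q) = subst_sqrt C P + subst_sqrt C Q.
Proof. by rewrite /subst_sqrt !raddfD. Qed.

Lemma subst_sqrtZ (R : realType) (C c : R) (P : {poly R}) :
  subst_sqrt C (c *: P) = c *: subst_sqrt C P.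
Proof. by rewrite /subst_sqrt even_polyZ linearZ. Qed.

Lemma subst_chebTz_addB (R : realType) (C : R) (m : int) (k : nat) :
  ~~ odd (absz m) -> ~~ odd k ->
  subst_sqrt C (chebTz R (m + k%:Z)) + subst_sqrt C (chebTz R (m - k%:Z)) =
  2 *: subst_sqrt C (chebT R k) * subst_sqrt C (chebTz R m).
Proof.
move=> em ek; rewrite -subst_sqrtD chebTz_addB subst_sqrtZ -scalerAl subst_sqrtM //.
  exact: (odd_chebT R _).2.
exact: even_chebTz.
Qed.

(** Since [2pq > 1], the signed index [k] has the sign of [n] when [n != 0].
    If both are negative, then [N + 1 = |k - 1|] and [N - 1 = |k + 1|]:
    exchanging the two terms accounts for [eps_n]. *)
Lemma Ypoly_mulz (R : realType) (p q a b : nat) (n : int) :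
  (0 < p)%N -> (0 < q)%N -> 0 < constC R p q a b ->
  let C := constC R p q a b in let k := (2 * p * q)%N%:Z * n + 1 in
  ('X - (4 * C)%:P) * Ypoly R p q a b n =
  (2 * C) *: (subst_sqrt C (chebTz R (k + 1)) - subst_sqrt C (chebTz R (k - 1))).
Proof.
move=> p0 q0 C0 C k; have d0 : (0 < p * q)%N by rewrite muln_gt0 p0 q0.
have [n0|n0] := eqVneq n 0.
  (* Here [k = 1], and [T_2 - T_0 = 2 (x^2 - 1)] with [x^2 = t / 4C]. *)
  rewrite /k n0 mulr0 add0r subrr /Ypoly eqxx mulr1 /chebTz /=.
  have oX : odd_poly 'X = 1 :> {poly R}.
    by rewrite -['X]mul1r odd_polyMX -polyC1 even_polyC.
  have C4 : 4 * C != 0 by rewrite mulf_neq0 ?pnatr_eq0 // gt_eqF.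
  rewrite /subst_sqrt (raddfB (@even_poly R)) /= even_polyZ even_polyMX oX mul1r.
  rewrite -polyC1 even_polyC comp_polyB comp_polyZ comp_polyX comp_polyC.
  rewrite -addrA -opprD -polyCD scalerBr !scalerA -[_ *: _%:P]mul_polyC -polyCM.
  have -> : 2 * C * 2 = 4 * C by ring.
  by rewrite divff // scale1r; congr (_ - _%:P); ring.
rewrite Ypoly_mul // -/C /chebTz /absN -/k; case: ltgtP n0 => // n0 _.
  have kP : 0 < k by rewrite /k -mulnA; move: (p * q)%N d0 => d d0; nia.
  have -> : absz (k + 1) = (absz k).+1 by lia.
  have -> : absz (k - 1) = (absz k).-1 by lia.
  by rewrite mul1r.
have kN : k < 0 by rewrite /k -mulnA; move: (p * q)%N d0 => d d0; nia.
have -> : absz (k + 1) = (absz k).-1 by lia.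
have -> : absz (k - 1) = (absz k).+1 by lia.
by rewrite mulN1r scaleNr -scalerN opprB.
Qed.

Theorem proposition5p1 (R : realType) (p q a b : nat)
  (p_gt0 : (0 < p)%N) (q_gt0 : (0 < q)%N) (p_odd : odd p) (q_odd : odd q)
  (pq_coprime : coprime p q)
  (a_odd : odd a) (b_odd : odd b)
  (a_bounds : (0 < a < 2 * p)%N) (b_bounds : (0 < b < q)%N) (n : int) :
  Ypoly R p q a b (n + 1) =
    Dpoly R p q a b * Ypoly R p q a b n - Ypoly R p q a b (n - 1).
Proof.
have C0 : 0 < constC R p q a b by exact: constC_gt0.
have ed : ~~ odd (2 * p * q) by rewrite -mulnA oddM.
apply: (mulfI (negbT (polyXsubC_eq0 (4 * constC R p q a b)))).
rewrite mulrBr (mulrCA _ (Dpoly _ _ _ _ _)) !Ypoly_mulz // /Dpoly.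
set C := constC R p q a b; set d := (2 * p * q)%N in ed *.
set k := d%:Z * n + 1.
have -> : d%:Z * (n + 1) + 1 = k + d%:Z by rewrite /k; ring.
have -> : d%:Z * (n - 1) + 1 = k - d%:Z by rewrite /k; ring.
have eD : ~~ odd (absz (k + 1)) by rewrite /k; lia.
have eB : ~~ odd (absz (k - 1)) by rewrite /k; lia.
rewrite (addrAC k d%:Z 1) (addrAC k d%:Z (- 1)).
rewrite (addrAC k (- d%:Z) 1) (addrAC k (- d%:Z) (- 1)).
rewrite -scalerAr mulrBr -(subst_chebTz_addB C eD ed) -(subst_chebTz_addB C eB ed).
by rewrite -scalerBr; congr (_ *: _); ring.
Qed.
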